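(* Let $M=Z(f_1,\dots,f_k)\subset U\subset\mathbb{R}^N$ for a convex set $U$, where $f_1,\dots,f_k:\mathbb{R}^N\to\mathbb{R}$ are smooth functions and $M$ is a closed embedded smooth submanifold of $\mathbb{R}^N$, and let $u_i:=\operatorname{grad}f_i$. Let $g\in C^\infty(\mathbb{R}^N,\mathbb{R}^{k\times k})$ be the matrix with entries $g_{ij}=\langle u_i,u_j\rangle$. Assume that the bounds $$\|g\|_1\le C_4,\qquad |\det g|\ge C_5,\qquad |\operatorname{Hess}f_i|_2\le C_6,\qquad |\operatorname{grad}f_i|_{\mathbb{R}^N}\le C_7$$ hold on $U$. Then the reach $\tau$ of $M$ satisfies $$\tau\ \ge\ \min\left\{k^{-4-(k-1)/4}\,\frac{C_5^{1/2}}{C_4^{(k-1)/2}C_6},\quad \frac12\cdot\frac{1}{2kC_6C_3(C_7C_3k+1)}\right\},$$ where $$C_3=N^{4+(N-1)/4}\,\frac{\|g\|_1^{(N-1)/2}}{|\det g|^{1/2}}.$$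
   Context: Closed submanifold means compact without boundary. $Z(f_1,\dots,f_k)$ is the common zero set. $|\cdot|_{\mathbb{R}^N}$ is the Euclidean norm; $|A|_2$ is the operator norm induced by the Euclidean norm and $\|A\|_1$ is the matrix $1$-norm (maximal absolute column sum). The expression $C_3$ is defined for linearly independent vectors $u_1,\dots,u_k\in\mathbb{R}^N$ with $g_{ij}=\langle u_i,u_j\rangle$, and is here formed with $u_i=\operatorname{grad}f_i$. For $p\in\mathbb{R}^N$ let $d(p,M)=\inf_{s\in M}|s-p|_{\mathbb{R}^N}$, let $\pi_M(p)=\{x\in M: |p-x|_{\mathbb{R}^N}=d(p,M)\}$, and for $r\ge 0$ let $U_M^r=\{p\in\mathbb{R}^N:d(p,M)<r\}$. The reach of $M$ is $\tau=\sup\{r\ge0: \pi_M(p)\text{ consists of exactly one point for all }p\in U_M^r\}$. *)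

(* Defs.v *)
From HB Require Import structures.
From mathcomp Require Import all_boot all_order all_algebra.
From mathcomp Require Import all_classical all_reals all_analysis.

Set Implicit Arguments.
Unset Strict Implicit.
Unset Printing Implicit Defensive.

Import Order.TTheory GRing.Theory Num.Theory.
Import numFieldNormedType.Exports.

Local Open Scope classical_set_scope.
Local Open Scope ring_scope.

(* Points of R^n are row vectors. The library norm `|x| on 'rV[R]_n is the sup
   norm: it gives the usual topology, but lengths are measured by [enorm]. *)

Definition dotp {R : realType} {n : nat} (u v : 'rV[R]_n) : R :=
  \sum_(i < n) u 0 i * v 0 i.

Definition enorm {R : realType} {n : nat} (u : 'rV[R]_n) : R :=
  Num.sqrt (dotp u u).

(* v *m A^T is A applied to v, written as a row vector. The set is nonempty
   and bounded above, so [sup] is a genuine supremum. *)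
Definition opnorm2 {R : realType} {n : nat} (A : 'M[R]_n) : R :=
  sup [set enorm (v *m A^T) | v in [set v : 'rV[R]_n | enorm v <= 1]].

Definition norm1 {R : realType} {m n : nat} (A : 'M[R]_(m, n)) : R :=
  \big[Num.max/0]_(j < n) \sum_(i < m) `|A i j|.

Fixpoint partials {R : realType} {n : nat} (s : seq 'I_n)
    (h : 'rV[R]_n -> R) : 'rV[R]_n -> R :=
  if s is i :: s' then 'D_('e_i) (partials s' h) else h.

(* C^oo on V, for V open: all iterated partial derivatives exist and are
   continuous at every point of V. *)
Definition smooth_on {R : realType} {n : nat} (V : set 'rV[R]_n)
    (h : 'rV[R]_n -> R) : Prop :=
  forall (s : seq 'I_n) (x : 'rV[R]_n), V x ->
    {for x, continuous (partials s h)} /\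
    forall i : 'I_n, derivable (partials s h) x 'e_i.

Definition smooth {R : realType} {n : nat} (h : 'rV[R]_n -> R) : Prop :=
  smooth_on setT h.

Definition grad {R : realType} {n : nat} (h : 'rV[R]_n -> R) (x : 'rV[R]_n) :
    'rV[R]_n :=
  \row_(i < n) 'D_('e_i) h x.

Definition hess {R : realType} {n : nat} (h : 'rV[R]_n -> R) (x : 'rV[R]_n) :
    'M[R]_n :=
  \matrix_(i < n, j < n) 'D_('e_i) ('D_('e_j) h) x.

Definition smooth_map_on {R : realType} {m n : nat} (V : set 'rV[R]_m)
    (phi : 'rV[R]_m -> 'rV[R]_n) : Prop :=
  forall i : 'I_n, smooth_on V (fun x => phi x 0 i).

Definition diffeomorphism {R : realType} {n : nat} (V W : set 'rV[R]_n)
    (phi psi : 'rV[R]_n -> 'rV[R]_n) : Prop :=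
  [/\ smooth_map_on V phi, smooth_map_on W psi,
      (forall x, V x -> W (phi x) /\ psi (phi x) = x) &
      (forall y, W y -> V (psi y) /\ phi (psi y) = y)].

(* Embedded smooth submanifold without boundary, by slice charts: near each of
   its points, M is carried to the slice R^d x {0} by a local diffeomorphism of
   the ambient space. *)
Definition embedded_submanifold {R : realType} {n : nat} (M : set 'rV[R]_n) :
    Prop :=
  exists2 d : nat, (d <= n)%N &
  forall p, M p -> exists (V W : set 'rV[R]_n) (phi psi : 'rV[R]_n -> 'rV[R]_n),
    [/\ open V /\ open W, V p, diffeomorphism V W phi psi &
        forall x, V x ->
          (M x <-> forall i : 'I_n, (d <= i)%N -> phi x 0 i = 0)].

Definition closed_embedded_submanifold {R : realType} {n : nat}
    (M : set 'rV[R]_n) : Prop :=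
  compact M /\ embedded_submanifold M.

Definition zero_set {R : realType} {n k : nat} (f : 'I_k -> 'rV[R]_n -> R) :
    set 'rV[R]_n :=
  [set x | forall i, f i x = 0].

(* Extended-real valued: the distance to the empty set is +oo. *)
Definition dist_to {R : realType} {n : nat} (M : set 'rV[R]_n)
    (p : 'rV[R]_n) : \bar R :=
  ereal_inf [set (enorm (s - p))%:E | s in M].

Definition nearest {R : realType} {n : nat} (M : set 'rV[R]_n)
    (p : 'rV[R]_n) : set 'rV[R]_n :=
  [set x | M x /\ (enorm (p - x))%:E = dist_to M p].

Definition tube {R : realType} {n : nat} (M : set 'rV[R]_n) (r : R) :
    set 'rV[R]_n :=
  [set p | (dist_to M p < r%:E)%E].

(* Possibly +oo, e.g. when M is a point. *)
Definition reach {R : realType} {n : nat} (M : set 'rV[R]_n) : \bar R :=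
  ereal_sup [set r%:E | r in
    [set r : R | 0 <= r /\ forall p, tube M r p -> exists! x, nearest M p x]].

Definition gram {R : realType} {n k : nat} (u : 'I_k -> 'rV[R]_n) : 'M[R]_k :=
  \matrix_(i < k, j < k) dotp (u i) (u j).

Definition C3 {R : realType} {n k : nat} (u : 'I_k -> 'rV[R]_n) : R :=
  n%:R `^ (4 + (n%:R - 1) / 4)
  * (norm1 (gram u) `^ ((n%:R - 1) / 2) / Num.sqrt `|\det (gram u)|).

Definition grads {R : realType} {n k : nat} (f : 'I_k -> 'rV[R]_n -> R)
    (x : 'rV[R]_n) : 'I_k -> 'rV[R]_n :=
  fun i => grad (f i) x.

(* Main.v *)
Require Import Defs.
From mathcomp Require Import all_boot all_order all_algebra.
From mathcomp Require Import all_classical all_reals all_analysis.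
From mathcomp Require Import ring lra.

Import Order.TTheory GRing.Theory Num.Theory.
Import numFieldNormedType.Exports.

Local Open Scope classical_set_scope.
Local Open Scope ring_scope.

(** Let x and y be two points of M nearest to
    the same p, and put w = p - x, v = y - x. Being equally far from p they
    satisfy |v|^2 = 2 <w, v>. By the Lagrange multiplier rule w is a combination
    of the gradients u_i at x ([lagrange_orthogonality]), so <w, v> = <w, n> where
    n is the projection of v on the span of the u_i.

    On the other hand n is quadratically small. Since f_i vanishes at both ends of
    the segment from x to y, which lies in the convex set U, Taylor's formula
    gives |<u_i, v>| <= C6 |v|^2 / 2 ([gradient_secant]). Solving for n with the
    inverse Gram matrix, whose entries are cofactors over the determinant and
    hence at most C4^(k-1) / C5, yields
    |n| <= k C6 C4^((k-1)/2) C5^(-1/2) |v|^2 / 2 ([normal_part]).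

    Together, |v|^2 <= 2 |w| |n| forces
    |w| >= C5^(1/2) / (k C6 C4^((k-1)/2)) ([nearest_points_far]). Closer to M than
    this, nearest points are therefore unique, and they exist because M is
    compact; so the reach is at least this number ([zero_set_reach_ge]). As
    k^(-4-(k-1)/4) <= 1/k, it is at least the first entry of the minimum. *)

(** * Derivatives along lines *)

Section Calculus.
Context {R : realType}.

Lemma is_derive_line {V : normedModType R} (h : V -> R) (x v : V) (t d : R) :
  is_derive (x + t *: v) v h d -> is_derive t 1 (fun s => h (x + s *: v)) d.
Proof.
move=> [dh <-].
have E : (fun s => s^-1 *: (((fun s => h (x + s *: v)) \o shift t) (s *: 1)
            - h (x + t *: v))) =
   (fun s => s^-1 *: ((h \o shift (x + t *: v)) (s *: v) - h (x + t *: v))).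
  apply/funext => s /=; congr (_ *: (h _ - _)).
  by rewrite [s *: 1]mulr1 scalerDl addrCA addrA.
by split; rewrite /derivable /derive E.
Qed.

Lemma is_derive_scale_dir {V : normedModType R} (h : V -> R) (x v : V) (c d : R) :
  is_derive x v h d -> is_derive x (c *: v) h (c * d).
Proof.
move=> dh.
have dl : is_derive (0 : R) 1 (fun s : R => h (x + s *: v)) d.
  by apply: is_derive_line; rewrite scale0r addr0.
have dc : is_derive (0 : R) 1 ( *%R c) c.
  have : is_derive (0 : R) 1 (c \*: (@id R)) (c *: (1 : R)) by apply: is_deriveZ.
  by rewrite [c *: 1]mulr1.
have dl' : is_derive (c * 0) 1 (fun s : R => h (x + s *: v)) d by rewrite mulr0.
have [dhc hc] := @is_derive1_comp _ _ _ _ _ _ dl' dc.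
have E : (fun s => s^-1 *: ((((fun s : R => h (x + s *: v)) \o *%R c) \o shift 0)
                (s *: 1) - ((fun s : R => h (x + s *: v)) \o *%R c) 0)) =
   (fun s => s^-1 *: ((h \o shift x) (s *: (c *: v)) - h x)).
  apply/funext => s /=; congr (_ *: (h _ - h _)).
    by rewrite addr0 [s *: 1]mulr1 scalerA addrC mulrC.
  by rewrite mulr0 scale0r addr0.
split.
  by move: dhc; rewrite /derivable E.
by rewrite mulrC -hc /derive E.
Qed.

Lemma is_derive_continuous (phi dphi : R -> R) :
  (forall t : R, is_derive t 1 phi (dphi t)) -> continuous phi.
Proof.
move=> dphi_ t; apply: differentiable_continuous.
by apply/derivable1_diffP; apply: ex_derive.
Qed.

Lemma MVT01 (phi dphi : R -> R) :
  (forall t : R, is_derive t 1 phi (dphi t)) ->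
  exists2 c, 0 <= c <= 1 & phi 1 - phi 0 = dphi c.
Proof.
move=> dP; have [|c] := @MVT _ phi dphi 0 1 ltr01 (fun t _ => dP t).
  exact/continuous_subspaceT/(is_derive_continuous _ _ dP).
rewrite in_itv/= => /andP[c0 c1] ->; exists c; first by rewrite !ltW.
by rewrite subr0 mulr1.
Qed.

(** A merely directional derivative is not additive in the direction; here
    additivity comes from the continuity of 'D_a h at x. The increment splits as
    a step along b from x, followed by a step along a from a nearby point; the
    mean value theorem turns the second step into a value of 'D_a h near x. *)
Lemma is_derive_add_dir {V : normedModType R} (h : V -> R) (x a b : V) (d : R) :
  is_derive x b h d -> (forall y, derivable h y a) ->
  {for x, continuous ('D_a h)} -> is_derive x (b + a) h (d + 'D_a h x).
Proof.
move=> [db hb] da ca.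
have split_quot : (fun s : R => s^-1 *: ((h \o shift x) (s *: (b + a)) - h x)) =
   (fun s : R => s^-1 *: (h (s *: b + x + s *: a) - h (s *: b + x))
            + s^-1 *: ((h \o shift x) (s *: b) - h x)).
  apply/funext => s /=; rewrite -scalerDr; congr (_ *: _).
  rewrite addrA subrK; congr (h _ - _).
  by rewrite scalerDr addrAC.
suff lim_a : s^-1 *: (h (s *: b + x + s *: a) - h (s *: b + x)) @[s --> 0^'] -->
    'D_a h x.
  have lim_ab : s^-1 *: ((h \o shift x) (s *: (b + a)) - h x) @[s --> 0^'] -->
      d + 'D_a h x.
    rewrite split_quot addrC; apply: cvgD => //.
    by rewrite -hb; exact: db.
  split; first by apply/cvg_ex; exists (d + 'D_a h x).
  by apply/cvg_lim.
apply/cvgrPdist_lt => e e0.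
have /nbhs_ballP[/= r r0 near_x] : \forall y \near x, `|'D_a h x - 'D_a h y| < e.
  by move/cvgrPdist_lt : ca => /(_ e e0).
have nb : 0 < `|b| + `|a| + 1 by rewrite ltr_wpDl// addr_ge0.
near=> s.
have s_neq0 : s != 0 by near: s; exact: nbhs_dnbhs_neq.
have s_lt : `|s| < r / (`|b| + `|a| + 1).
  near: s; apply: dnbhs0_lt; exact: divr_gt0.
have dline (t : R) : is_derive t 1 (fun t => h (s *: b + x + t *: (s *: a)))
     (s * 'D_a h (s *: b + x + t *: (s *: a))).
  by apply: is_derive_line; apply: is_derive_scale_dir; apply: derivableP.
have [c /andP[c0 c1]] := MVT01 _ _ dline.
rewrite scale1r scale0r addr0 => ->.
set y := s *: b + x + c *: (s *: a).
have -> : s^-1 *: (s * 'D_a h y) = 'D_a h y by exact: mulKf.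
apply: near_x.
rewrite -ball_normE /=.
have -> : x - y = - (s *: (b + c *: a)).
  rewrite /y [s *: b + x]addrC -!addrA opprD addrA subrr add0r scalerDr.
  congr (- (_ + _)).
  by rewrite !scalerA mulrC.
rewrite normrN normrZ (@le_lt_trans _ _ (`|s| * (`|b| + `|a| + 1)))//.
  rewrite ler_wpM2l// (le_trans (ler_normD _ _))// -addrA lerD2l.
  rewrite normrZ (@le_trans _ _ `|a|) ?lerDl//.
  by rewrite ler_piMl// ger0_norm.
by rewrite -ltr_pdivlMr.
Unshelve. all: by end_near. Qed.

End Calculus.

Section ContinuousGradient.
Context {R : realType} {n : nat}.
Implicit Types (h : 'rV[R]_n -> R) (x v : 'rV[R]_n).

Definition class_C1 h := forall i x,
  derivable h x 'e_i /\ {for x, continuous ('D_('e_i) h)}.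

(** Walk from x to x + v one coordinate axis at a time. *)
Lemma is_derive_grad h x v : class_C1 h -> is_derive x v h (dotp (grad h x) v).
Proof.
move=> hC1.
rewrite {1}(row_sum_delta v) /dotp.
elim/big_rec2 : _ => [|i d b _ db]; first exact: is_derive0.
have E y : 'D_(v 0 i *: 'e_i) h y = v 0 i * 'D_('e_i) h y.
  by have [] := is_derive_scale_dir h y 'e_i (v 0 i) _
                  (derivableP (hC1 i y).1).
have -> : grad h x 0 i * v 0 i + d = d + 'D_(v 0 i *: 'e_i) h x.
  by rewrite E mxE addrC mulrC.
rewrite [v 0 i *: _ + b]addrC; apply: is_derive_add_dir => //.
- move=> y; have [] // := is_derive_scale_dir h y 'e_i (v 0 i) _
                  (derivableP (hC1 i y).1).
- have -> : 'D_(v 0 i *: 'e_i) h = (fun y => v 0 i * 'D_('e_i) h y).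
    exact/funext.
  by apply: continuousM; [exact: cst_continuous|exact: (hC1 i x).2].
Qed.

Lemma is_derive_grad_line h x v (t : R) : class_C1 h ->
  is_derive t 1 (fun s => h (x + s *: v)) (dotp (grad h (x + t *: v)) v).
Proof. by move=> hC1; apply: is_derive_line; exact: is_derive_grad. Qed.

Lemma smooth_C1 h : smooth h -> class_C1 h.
Proof.
move=> sh i x; have [_ /(_ i)] := sh [::] x I; split => //.
by have [] := sh [:: i] x I.
Qed.

Lemma smooth_continuous h : smooth h -> continuous h.
Proof. by move=> sh x; have [] := sh [::] x I. Qed.

Lemma smooth_partial h i : smooth h -> smooth ('D_('e_i) h).
Proof.
move=> sh s x _.
have E : partials s ('D_('e_i) h) = partials (rcons s i) h.
  by elim: s => //= j s ->.
by rewrite E; exact: sh.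
Qed.

End ContinuousGradient.

(** * Euclidean geometry and the operator norm *)

Section Euclid.
Context {R : realType} {n : nat}.
Implicit Types (u v w : 'rV[R]_n) (a : R).

Lemma dotpC u v : dotp u v = dotp v u.
Proof. by apply: eq_bigr => i _; rewrite mulrC. Qed.

Lemma dotpDl u v w : dotp (u + v) w = dotp u w + dotp v w.
Proof. by rewrite -big_split; apply: eq_bigr => i _; rewrite mxE mulrDl. Qed.

Lemma dotpZl a u w : dotp (a *: u) w = a * dotp u w.
Proof. by rewrite mulr_sumr; apply: eq_bigr => i _; rewrite mxE mulrA. Qed.

Lemma dotpNl u w : dotp (- u) w = - dotp u w.
Proof. by rewrite -scaleN1r dotpZl mulN1r. Qed.

Lemma dotpBl u v w : dotp (u - v) w = dotp u w - dotp v w.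
Proof. by rewrite dotpDl dotpNl. Qed.

Lemma dotpDr u v w : dotp w (u + v) = dotp w u + dotp w v.
Proof. by rewrite dotpC dotpDl !(dotpC w). Qed.

Lemma dotpZr a u w : dotp w (a *: u) = a * dotp w u.
Proof. by rewrite dotpC dotpZl (dotpC w). Qed.

Lemma dotpBr u v w : dotp w (u - v) = dotp w u - dotp w v.
Proof. by rewrite dotpC dotpBl !(dotpC w). Qed.

Lemma dotp_sumr (I : finType) (F : I -> 'rV[R]_n) w :
  dotp w (\sum_i F i) = \sum_i dotp w (F i).
Proof.
rewrite exchange_big; apply: eq_bigr => j _.
by rewrite summxE mulr_sumr.
Qed.

Lemma dotp_ge0 u : 0 <= dotp u u.
Proof. by apply: sumr_ge0 => i _; rewrite -expr2 sqr_ge0. Qed.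

Lemma dotp0l u : dotp 0 u = 0.
Proof. by rewrite -(scale0r 0) dotpZl mul0r. Qed.

Lemma dotp_eq0 u : (dotp u u == 0) = (u == 0).
Proof.
apply/eqP/eqP => [|->]; last exact: dotp0l.
move/eqP; rewrite psumr_eq0 => [/allP uu0|i _]; last by rewrite -expr2 sqr_ge0.
apply/rowP => i; rewrite mxE; apply/eqP.
by have := uu0 i (mem_index_enum i); rewrite mulf_eq0 orbb.
Qed.

Lemma dotp_CS u v : dotp u v ^+ 2 <= dotp u u * dotp v v.
Proof.
have [/eqP|v0] := boolP (dotp v v == 0).
  move=> /eqP; rewrite dotp_eq0 => /eqP ->.
  by rewrite dotpC !dotp0l expr0n mulr0.
have v_gt0 : 0 < dotp v v by rewrite lt0r v0 dotp_ge0.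
have := dotp_ge0 (dotp v v *: u - dotp u v *: v).
rewrite !(dotpBl, dotpBr, dotpZl, dotpZr) (dotpC v u) => H.
rewrite -subr_ge0 -(pmulr_rge0 _ v_gt0).
by move: H; congr (_ <= _); ring.
Qed.

Lemma sqr_enorm u : enorm u ^+ 2 = dotp u u.
Proof. by rewrite sqr_sqrtr ?dotp_ge0. Qed.

Lemma sqr_enormB u v :
  enorm (u - v) ^+ 2 = enorm u ^+ 2 - 2 * dotp u v + enorm v ^+ 2.
Proof. by rewrite !sqr_enorm !(dotpBl, dotpBr) (dotpC v u); ring. Qed.

Lemma enorm_ge0 u : 0 <= enorm u.
Proof. exact: sqrtr_ge0. Qed.

Lemma enormN u : enorm (- u) = enorm u.
Proof. by rewrite /enorm dotpNl dotpC dotpNl opprK. Qed.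

Lemma enormZ a u : enorm (a *: u) = `|a| * enorm u.
Proof.
by rewrite /enorm dotpZl dotpZr mulrA -expr2 sqrtrM ?sqr_ge0// sqrtr_sqr.
Qed.

Lemma dotp_le_enorm u v : `|dotp u v| <= enorm u * enorm v.
Proof.
rewrite -ler_sqr ?nnegrE ?mulr_ge0 ?enorm_ge0// exprMn !sqr_enorm.
by rewrite real_normK ?num_real// dotp_CS.
Qed.

Lemma enorm_eq0 u : (enorm u == 0) = (u == 0).
Proof. by rewrite /enorm sqrtr_eq0 -dotp_eq0 eq_le dotp_ge0 andbT. Qed.

Lemma enorm_le_sum u : enorm u <= \sum_i `|u 0 i|.
Proof.
have s0 : 0 <= \sum_i `|u 0 i| by exact: sumr_ge0.
rewrite -ler_sqr ?nnegrE ?enorm_ge0// sqr_enorm expr2 mulr_suml.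
apply: ler_sum => i _; rewrite (le_trans (ler_norm _))// normrM ler_wpM2l//.
by rewrite (bigD1 i)//= lerDl sumr_ge0.
Qed.

Lemma coord_le_enorm u i : `|u 0 i| <= enorm u.
Proof.
rewrite -ler_sqr ?nnegrE ?enorm_ge0// sqr_enorm real_normK ?num_real//.
rewrite /dotp (bigD1 i)//= -expr2 lerDl sumr_ge0// => j _.
by rewrite -expr2 sqr_ge0.
Qed.

Lemma opnorm2_ub (A : 'M[R]_n) v : enorm v <= 1 ->
  enorm (v *m A^T) <= opnorm2 A.
Proof.
move=> v1; apply: sup_upper_bound; last by exists v.
split; first by exists (enorm (v *m A^T)), v.
exists (\sum_i \sum_j `|A i j|) => _ [w /= w1 <-].
apply: le_trans (enorm_le_sum _) _; apply: ler_sum => i _.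
rewrite mxE (le_trans (ler_norm_sum _ _ _))//; apply: ler_sum => j _.
rewrite mxE normrM ler_piMl//. exact: (le_trans (coord_le_enorm w j) w1).
Qed.

Lemma opnorm2_ge0 (A : 'M[R]_n) : 0 <= opnorm2 A.
Proof.
have z1 : enorm (0 : 'rV[R]_n) <= 1.
  by rewrite [X in X <= _](_ : _ = 0) ?ler01//; apply/eqP; rewrite enorm_eq0.
exact: (le_trans (enorm_ge0 _) (opnorm2_ub A _ z1)).
Qed.

(** Cauchy-Schwarz after rescaling v to a unit vector, where the supremum
    defining the operator norm applies. *)
Lemma quad_le_opnorm2 (A : 'M[R]_n) v :
  `|dotp v (v *m A^T)| <= opnorm2 A * enorm v ^+ 2.
Proof.
have [->|v0] := eqVneq v 0.
  by rewrite dotp0l normr0 mulr_ge0 ?opnorm2_ge0 ?sqr_ge0.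
have v_gt0 : 0 < enorm v by rewrite lt0r enorm_eq0 v0 enorm_ge0.
have : enorm ((enorm v)^-1 *: v) <= 1.
  by rewrite enormZ gtr0_norm ?invr_gt0// mulVf// gt_eqF.
move/(opnorm2_ub A); rewrite -scalemxAl enormZ gtr0_norm ?invr_gt0//.
rewrite mulrC ler_pdivrMr// => H.
apply: le_trans (dotp_le_enorm _ _) _.
by rewrite expr2 mulrCA ler_wpM2l// enorm_ge0.
Qed.

End Euclid.

(** * Second-order Taylor estimate *)

Section Taylor.
Context {R : realType}.

Lemma nincr01 (phi dphi : R -> R) :
  (forall t : R, is_derive t 1 phi (dphi t)) ->
  (forall t, 0 <= t <= 1 -> dphi t <= 0) ->
  forall t, 0 <= t <= 1 -> phi t <= phi 0.
Proof.
move=> dP le0 t /andP[t0 t1].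
apply: (@ler0_derive1_nincr _ phi 0 1) => //.
- by move=> s; rewrite in_itv/= => /andP[s0 s1]; rewrite derive1E derive_val le0// !ltW.
- exact/continuous_subspaceT/(is_derive_continuous _ _ dP).
Qed.

(** Comparing dphi, then phi, with the solutions of the extremal equation
    ddphi = K gives the sharp constant K / 2; the mean value theorem alone would
    only give K. For a single equation the first entry of the minimum leaves no
    room for that factor. *)
Lemma taylor2_le (phi dphi ddphi : R -> R) (K : R) :
  (forall t : R, is_derive t 1 phi (dphi t)) ->
  (forall t : R, is_derive t 1 dphi (ddphi t)) ->
  (forall t, 0 <= t <= 1 -> ddphi t <= K) ->
  phi 1 - phi 0 - dphi 0 <= K / 2.
Proof.
move=> dP ddP leK.
have dlin (c : R) (t : R) : is_derive t 1 (fun s => c * s) c.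
  have : is_derive t 1 (c \*: (@id R)) (c *: (1 : R)) by apply: is_deriveZ.
  by rewrite [c *: 1]mulr1.
have dsqr (t : R) : is_derive t 1 (fun s => K / 2 * (s ^+ 2)) (K * t).
  have : is_derive t 1 ((K / 2) \*: ((@id R) ^+ 2)) ((K / 2) *: ((2%:R * t) *: (1 : R))).
    by apply: is_deriveZ.
  have -> : (K / 2) *: ((2%:R * t) *: (1 : R)) = K * t.
    by rewrite [_ *: 1]mulr1 [LHS]mulrA; congr (_ * t); field.
  by [].
have slope t : 0 <= t <= 1 -> dphi t - K * t - dphi 0 <= 0.
  move=> t01; rewrite subr_le0.
  rewrite -[leRHS]subr0 -[X in _ <= _ - X](mulr0 K).
  apply: (@nincr01 (fun s => dphi s - K * s) (fun s => ddphi s - K)) => // s s01.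
  by rewrite subr_le0 leK.
have dremainder (t : R) : is_derive t 1
    (fun s => phi s - dphi 0 * s - K / 2 * s ^+ 2) (dphi t - dphi 0 - K * t).
  by apply: is_deriveB.
have remainder_le0 t : 0 <= t <= 1 -> dphi t - dphi 0 - K * t <= 0.
  by move=> /slope; lra.
have := nincr01 _ _ dremainder remainder_le0 1.
by rewrite ler01 lexx !mulr0 expr0n mulr0 expr1n => /(_ isT); lra.
Qed.

Context {n : nat}.
Implicit Types (h : 'rV[R]_n -> R) (x v : 'rV[R]_n).

Lemma is_derive_grad_dotp h x v (t : R) : smooth h ->
  is_derive t 1 (fun s => dotp (grad h (x + s *: v)) v)
    (dotp v (v *m (hess h (x + t *: v))^T)).
Proof.
move=> sh; set y := x + t *: v.
have dterm i : is_derive t 1 (fun s => v 0 i * 'D_('e_i) h (x + s *: v))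
    (v 0 i * dotp (grad ('D_('e_i) h) y) v).
  have := is_derive_grad_line ('D_('e_i) h) x v t (smooth_C1 _ (smooth_partial _ i sh)).
  by move=> d; apply: is_deriveZ.
have -> : (fun s => dotp (grad h (x + s *: v)) v) =
    \sum_i (fun s => v 0 i * 'D_('e_i) h (x + s *: v)).
  apply/funext => s; rewrite fct_sumE; apply: eq_bigr => i _.
  by rewrite mxE mulrC.
have -> : dotp v (v *m (hess h y)^T) = \sum_i v 0 i * dotp (grad ('D_('e_i) h) y) v.
  rewrite /dotp; under eq_bigr do rewrite mxE mulr_sumr.
  rewrite exchange_big; apply: eq_bigr => i _; rewrite mulr_sumr.
  by apply: eq_bigr => j _; rewrite !mxE mulrC -!mulrA; congr (_ * _); rewrite mulrC.
exact: is_derive_sum.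
Qed.

Lemma taylor2_norm h x v (C : R) : smooth h ->
  (forall t, 0 <= t <= 1 -> opnorm2 (hess h (x + t *: v)) <= C) ->
  `|h (x + v) - h x - dotp (grad h x) v| <= C / 2 * enorm v ^+ 2.
Proof.
move=> sh leC.
have dP (t : R) := is_derive_grad_line h x v t (smooth_C1 _ sh).
have ddP (t : R) := is_derive_grad_dotp h x v t sh.
have bound t : 0 <= t <= 1 ->
    `|dotp v (v *m (hess h (x + t *: v))^T)| <= C * enorm v ^+ 2.
  move=> t01; apply: le_trans (quad_le_opnorm2 _ _) _.
  by rewrite ler_wpM2r ?sqr_ge0// leC.
have up := taylor2_le _ _ _ _ dP ddP
  (fun t t01 => le_trans (ler_norm _) (bound t t01)).
have dN (f df : R -> R) : (forall t : R, is_derive t 1 f (df t)) ->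
    forall t : R, is_derive t 1 (fun s => - f s) (- df t).
  by move=> df_ t; apply: is_deriveN.
have lo := taylor2_le _ _ _ (C * enorm v ^+ 2) (dN _ _ dP) (dN _ _ ddP).
move: up lo; rewrite scale1r scale0r addr0 => up lo.
rewrite ler_norml mulrAC up andbT.
suff : - h (x + v) - - h x - - dotp (grad h x) v <= C * enorm v ^+ 2 / 2 by lra.
apply: lo => t t01; apply: le_trans (bound t t01).
by rewrite -normrN ler_norm.
Qed.

End Taylor.

(** * Gram matrices and orthogonal projection *)

Section Gram.
Context {R : realType}.

Lemma norm1_ge0 m n (A : 'M[R]_(m, n)) : 0 <= norm1 A.
Proof. by rewrite /norm1; apply/bigmax_geP; left. Qed.

Lemma col_sum_le_norm1 m n (A : 'M[R]_(m, n)) j :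
  \sum_i `|A i j| <= norm1 A.
Proof. exact: (@le_bigmax _ _ _ 0 (fun j => \sum_i `|A i j|) j). Qed.

Lemma norm1_row'_col' m n (A : 'M[R]_(m.+1, n.+1)) i j :
  norm1 (row' i (col' j A)) <= norm1 A.
Proof.
apply/bigmax_leP; split=> [|l _]; first exact: norm1_ge0.
apply: le_trans (col_sum_le_norm1 _ _ A (lift j l)).
rewrite [leRHS](bigD1_ord i)//= ler_wpDl//.
by apply: ler_sum => a _; rewrite !mxE.
Qed.

(** Laplace expansion along the first column, by induction on the size: deleting
    a row and a column does not increase the column sums. *)
Lemma norm_det_le n (A : 'M[R]_n) : `|\det A| <= norm1 A ^+ n.
Proof.
elim: n A => [|n IH] A; first by rewrite det_mx00 normr1 expr0.
rewrite (expand_det_col A 0) (le_trans (ler_norm_sum _ _ _))//.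
rewrite exprS; apply: le_trans (ler_wpM2r _ (col_sum_le_norm1 _ _ A 0)); last first.
  exact/exprn_ge0/norm1_ge0.
rewrite mulr_suml; apply: ler_sum => i _; rewrite normrM ler_wpM2l//.
rewrite /cofactor normrM normrX normrN1 expr1n mul1r.
apply: le_trans (IH _) _.
by rewrite lerXn2r ?nnegrE ?norm1_ge0// norm1_row'_col'.
Qed.

Lemma norm_adj_le n (A : 'M[R]_n) i j : `|(\adj A) i j| <= norm1 A ^+ n.-1.
Proof.
case: n A i j => [|n] A i j; first by case: i.
rewrite mxE /cofactor normrM normrX normrN1 expr1n mul1r.
apply: le_trans (norm_det_le _ _) _.
by rewrite lerXn2r ?nnegrE ?norm1_ge0// norm1_row'_col'.
Qed.

Context {N k : nat}.
Implicit Types (u : 'I_k -> 'rV[R]_N) (v : 'rV[R]_N).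

(** The determinant of the Gram matrix times the orthogonal projection of v on
    the span of u. Having no division, it is polynomial in u and v, hence
    continuous even where the u i become dependent. *)
Definition adj_proj u v : 'rV[R]_N :=
  \sum_i \sum_j ((\adj (gram u)) i j * dotp (u j) v) *: u i.

Lemma dotp_adj_proj u v l :
  dotp (u l) (adj_proj u v) = \det (gram u) * dotp (u l) v.
Proof.
rewrite dotp_sumr.
transitivity (\sum_j (gram u *m \adj (gram u)) l j * dotp (u j) v).
  under eq_bigr do rewrite dotp_sumr.
  rewrite exchange_big; apply: eq_bigr => j _.
  rewrite mxE mulr_suml; apply: eq_bigr => i _.
  by rewrite dotpZr [gram u l i]mxE; ring.
rewrite mul_mx_adj (bigD1 l)//= mxE eqxx mulr1n big1 ?addr0// => j jl.
by rewrite mxE eq_sym (negbTE jl) mul0r.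
Qed.

(** Write b i for the inner product of u i with v. The projection w of v on the
    span of u has squared length b^T g^-1 b, where g is the Gram matrix, and the
    entries of g^-1 are cofactors divided by the determinant. This replaces a
    lower bound on the smallest eigenvalue of g. *)
Lemma normal_part u v : \det (gram u) != 0 ->
  exists w : 'rV[R]_N, (forall i, dotp (u i) (v - w) = 0) /\
    enorm w ^+ 2 <=
      norm1 (gram u) ^+ k.-1 / `|\det (gram u)| * (\sum_i `|dotp (u i) v|) ^+ 2.
Proof.
move=> d0; pose w := (\det (gram u))^-1 *: adj_proj u v; exists w.
have wE l : dotp (u l) w = dotp (u l) v.
  by rewrite dotpZr dotp_adj_proj mulKf.
split=> [i|]; first by rewrite dotpBr wE subrr.
rewrite sqr_enorm {2}/w dotpZr dotp_sumr.
have -> : \sum_i dotp w (\sum_j ((\adj (gram u)) i j * dotp (u j) v) *: u i) =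
    \sum_i \sum_j (\adj (gram u)) i j * dotp (u j) v * dotp (u i) v.
  apply: eq_bigr => i _; rewrite dotp_sumr; apply: eq_bigr => j _.
  by rewrite dotpZr (dotpC w) wE.
rewrite (le_trans (ler_norm _))// normrM normfV mulrAC mulrC ler_wpM2r ?invr_ge0//.
rewrite expr2 mulr_suml mulr_sumr (le_trans (ler_norm_sum _ _ _))//.
apply: ler_sum => i _; rewrite (le_trans (ler_norm_sum _ _ _))//.
rewrite mulr_sumr mulr_sumr; apply: ler_sum => j _.
rewrite !normrM -mulrA ler_pM ?mulr_ge0// ?norm_adj_le//.
by rewrite mulrC.
Qed.

End Gram.

(** * Continuity of determinants and adjugates *)

Section ContinuousMatrix.
Context {R : realType} {T : topologicalType}.
Implicit Types (x : T).

Lemma continuous_add_at (f g : T -> R) x :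
  {for x, continuous f} -> {for x, continuous g} ->
  {for x, continuous (fun z => f z + g z)}.
Proof. by move=> cf cg; exact: (continuousD cf cg). Qed.

Lemma continuous_sub_at (f g : T -> R) x :
  {for x, continuous f} -> {for x, continuous g} ->
  {for x, continuous (fun z => f z - g z)}.
Proof. by move=> cf cg; exact: (continuousB cf cg). Qed.

Lemma continuous_sum_at (I : finType) (P : pred I) (F : I -> T -> R) x :
  (forall i, {for x, continuous (F i)}) ->
  {for x, continuous (fun z => \sum_(i | P i) F i z)}.
Proof. by move=> cF; apply: cvg_big => [|i _]; [exact: add_continuous|exact: cF]. Qed.

Lemma continuous_prod_at (I : finType) (P : pred I) (F : I -> T -> R) x :
  (forall i, {for x, continuous (F i)}) ->
  {for x, continuous (fun z => \prod_(i | P i) F i z)}.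
Proof. by move=> cF; apply: cvg_big => [|i _]; [exact: mul_continuous|exact: cF]. Qed.

Lemma continuous_det_at n (A : T -> 'M[R]_n) x :
  (forall i j, {for x, continuous (fun z => A z i j)}) ->
  {for x, continuous (fun z => \det (A z))}.
Proof.
move=> cA; apply: continuous_sum_at => s.
by apply: continuousM; [exact: cst_continuous|exact: continuous_prod_at].
Qed.

Lemma continuous_adj_at n (A : T -> 'M[R]_n) x i j :
  (forall i j, {for x, continuous (fun z => A z i j)}) ->
  {for x, continuous (fun z => (\adj (A z)) i j)}.
Proof.
move=> cA.
have -> : (fun z => (\adj (A z)) i j) =
    (fun z => (-1) ^+ (j + i) * \det (row' j (col' i (A z)))).
  by apply/funext => z; rewrite mxE.
apply: continuousM; first exact: cst_continuous.
apply: continuous_det_at => a b.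
have -> : (fun z => (row' j (col' i (A z))) a b) =
    (fun z => A z (lift j a) (lift i b)) by apply/funext => z; rewrite !mxE.
exact: cA.
Qed.

Lemma continuous_dotp_at n (u v : T -> 'rV[R]_n) x :
  (forall i, {for x, continuous (fun z => u z 0 i)}) ->
  (forall i, {for x, continuous (fun z => v z 0 i)}) ->
  {for x, continuous (fun z => dotp (u z) (v z))}.
Proof. by move=> cu cv; apply: continuous_sum_at => i; exact: continuousM. Qed.

Lemma continuous_adj_proj_at N k (u : T -> 'I_k -> 'rV[R]_N) (v : 'rV[R]_N) x l :
  (forall i l, {for x, continuous (fun z => u z i 0 l)}) ->
  {for x, continuous (fun z => adj_proj (u z) v 0 l)}.
Proof.
move=> cu.
have -> : (fun z => adj_proj (u z) v 0 l) =
   (fun z => \sum_i \sum_j (\adj (gram (u z))) i j * dotp (u z j) v * u z i 0 l).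
  apply/funext => z; rewrite summxE; apply: eq_bigr => i _.
  by rewrite summxE; apply: eq_bigr => j _; rewrite mxE.
apply: continuous_sum_at => i; apply: continuous_sum_at => j.
apply: continuousM; last exact: cu.
apply: continuousM.
  apply: continuous_adj_at => a b.
  have -> : (fun z => gram (u z) a b) = (fun z => dotp (u z a) (u z b)).
    by apply/funext => z; rewrite mxE.
  exact: continuous_dotp_at.
by apply: continuous_dotp_at => // m; exact: cst_continuous.
Qed.

End ContinuousMatrix.

(** * Constrained minima and Lagrange multipliers *)

Section Penalty.
Context {R : realType}.

(** The only points of S where a large penalty cannot help are those with h = 0,
    and there F already exceeds c. On the compact part of S where F <= c, the
    function h is bounded below by a positive constant. *)
Lemma penalty_dominates {T : topologicalType} (S : set T) (F h : T -> R) (c : R) :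
  compact S -> continuous F -> continuous h ->
  (forall z, 0 <= h z) -> (forall z, S z -> h z = 0 -> c < F z) ->
  exists m : R, forall z, S z -> c < F z + m * h z.
Proof.
move=> cS cF ch h0 Fc; pose S' := S `&` F @^-1` [set y | y <= c].
have cS' : compact S'.
  apply: compact_closedI => //; apply: closed_comp; last exact: closed_le.
  by move=> y _; exact: cF.
have [[z0 S'z0]|S'0] := pselect (S' !=set0); last first.
  exists 0 => z Sz; rewrite mul0r addr0 ltNge; apply/negP => Fz.
  by apply: S'0; exists z.
have [z1 /set_mem[Sz1 /= Fz1] minF] :=
  compact_EVT_min (ex_intro _ z0 S'z0) cS' (continuous_subspaceT cF).
have [z2 /set_mem[Sz2 /= Fz2] minh] :=
  compact_EVT_min (ex_intro _ z0 S'z0) cS' (continuous_subspaceT ch).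
have hz2 : 0 < h z2.
  rewrite lt0r h0 andbT; apply/eqP => /(Fc _ Sz2).
  by rewrite ltNge Fz2.
(* F z >= F z1 and h z >= h z2 on S', so this multiplier lifts F z1 to c, and
   the added 1 makes the inequality strict. *)
exists ((c - F z1) / h z2 + 1) => z Sz.
have m1 : 1 <= (c - F z1) / h z2 + 1.
  by rewrite lerDr divr_ge0 ?subr_ge0// ltW.
have [cFz|Fzc] := ltP c (F z).
  by rewrite (lt_le_trans cFz)// lerDl mulr_ge0// (le_trans _ m1).
have S'z : z \in S' by apply/mem_set.
have := minF z S'z; have := minh z S'z => hz Fz.
have : ((c - F z1) / h z2 + 1) * h z2 <= ((c - F z1) / h z2 + 1) * h z.
  by rewrite ler_wpM2l// (le_trans _ m1).
rewrite mulrDl mul1r divfK ?gt_eqF// => H.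
by lra.
Qed.

Context {n : nat}.
Implicit Types (x z p s : 'rV[R]_n).

(** A strict minimum x of F on the zero set of h is a limit of local minima of
    the unconstrained functions F + m h: for m large the minimum over the ball
    of radius e is not attained on the sphere. *)
Lemma penalty_minimizer (F h : 'rV[R]_n -> R) x (e : R) : 0 < e ->
  continuous F -> continuous h -> (forall z, 0 <= h z) -> h x = 0 ->
  (forall z, h z = 0 -> z <> x -> F x < F z) ->
  exists (m : R) z, `|z - x| < e /\
    forall y, `|y - x| < e -> F z + m * h z <= F y + m * h y.
Proof.
move=> e0 cF ch h0 hx0 Fx.
have cdist : continuous (fun z => `|z - x|).
  move=> z; apply: (@continuous_comp _ _ _ (fun z => z - x) Num.norm).
    exact: (continuousB (@cvg_id _ _) (@cst_continuous _ _ x z)).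
  exact: norm_continuous.
have cB : compact [set z | `|z - x| <= e].
  apply: bounded_closed_compact.
    exists (`|x| + e); split; first exact: num_real.
    move=> M M_gt z /= ze; apply: le_trans (ltW M_gt).
    by rewrite -(subrK x z) (le_trans (ler_normD _ _))// addrC lerD2l.
  by apply: (@closed_comp _ _ (fun z => `|z - x|) [set y | y <= e]) => [z _|];
    [exact: cdist|exact: closed_le].
have cS : compact [set z | `|z - x| = e].
  apply: (subclosed_compact _ cB) => [|z /= ->//].
  by apply: (@closed_comp _ _ (fun z => `|z - x|) [set y | y = e]) => [z _|];
    [exact: cdist|exact: closed_eq].
have [|m Sm] := penalty_dominates _ F h (F x) cS cF ch h0.
  move=> z /= ze hz; apply: Fx => // zx.
  by move: ze; rewrite zx subrr normr0 => e0'; rewrite -e0' ltxx in e0.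
have cFh : continuous (fun z => F z + m * h z).
  move=> z; refine (continuous_add_at F _ z (cF z) _).
  by apply: continuousM; [exact: cst_continuous|exact: ch].
have Bx : [set z | `|z - x| <= e] x by rewrite /= subrr normr0 ltW.
have [z /set_mem /= Bz minz] :=
  compact_EVT_min (ex_intro _ x Bx) cB (continuous_subspaceT cFh).
exists m, z; split=> [|y ye]; last by apply: minz; apply/mem_set/ltW.
rewrite lt_neqAle Bz andbT; apply/eqP => /Sm.
have := minz x (mem_set Bx); rewrite hx0 mulr0 addr0.
by rewrite leNgt => /negbTE ->.
Qed.

Lemma is_derive_sqr_line (a s : 'rV[R]_n) (t : R) :
  is_derive t 1 (fun t => dotp (a + t *: s) (a + t *: s))
    (2 * dotp (a + t *: s) s).
Proof.
have -> : (fun t => dotp (a + t *: s) (a + t *: s)) =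
    cst (dotp a a) + (((2 * dotp a s) \*: (@id R)) + (dotp s s \*: ((@id R) ^+ 2))).
  apply/funext => r; rewrite !(dotpDl, dotpDr, dotpZl, dotpZr) (dotpC s a).
  rewrite !fctE /= /GRing.scale /=; ring.
apply: is_derive_eq.
rewrite dotpDl dotpZl /GRing.scale/= expr1; ring.
Qed.

Lemma line_min_derive0 (G : 'rV[R]_n -> R) (x z s : 'rV[R]_n) (e : R) (dG : R -> R) :
  `|z - x| < e -> (forall y, `|y - x| < e -> G z <= G y) ->
  (forall t : R, is_derive t 1 (fun t => G (z + t *: s)) (dG t)) -> dG 0 = 0.
Proof.
move=> ze minz dGs.
have s1 : 0 < `|s| + 1 by rewrite ltr_wpDl.
(* |t| < r keeps z + t *: s in the ball; the 1 covers s = 0. *)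
pose r := (e - `|z - x|) / (`|s| + 1).
have r0 : 0 < r by rewrite divr_gt0// subr_gt0.
have : is_derive (0 : R) 1 (fun t => G (z + t *: s)) 0.
  apply: (@derive1_at_min _ _ (- r) r) => [|t _||t].
  - by rewrite ge0_cp// ltW.
  - exact: ex_derive.
  - by rewrite in_itv/= oppr_lt0 r0.
  rewrite in_itv/= scale0r addr0 => tr; apply: minz.
  have {}tr : `|t| < r by rewrite ltr_norml.
  rewrite addrAC (le_lt_trans (ler_normD _ _))// normrZ -ltrBrDl.
  apply: (@le_lt_trans _ _ (`|t| * (`|s| + 1))); first by rewrite ler_wpM2l// lerDl.
  by rewrite -ltr_pdivlMr.
by move=> d0; rewrite -(@derive_val _ _ _ _ _ _ _ (dGs 0)) (@derive_val _ _ _ _ _ _ _ d0).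
Qed.

(** Lagrange multipliers for the distance to p on a zero set, by penalization,
    so that no curve in the zero set has to be constructed. Take F z to be
    |z - p|^2 + |z - x|^2, where the second term makes the minimum x strict, and
    h to be the sum of the squares of the f i. At a local minimum z of F + m h
    the gradient of F lies in the span of the gradients of the f i, so it is
    orthogonal to the vector s z, a multiple of the component of t orthogonal to
    that span. Such z exist arbitrarily close to x, everything is continuous,
    and s x is a nonzero multiple of t. *)
Lemma lagrange_orthogonality (k : nat) (f : 'I_k -> 'rV[R]_n -> R) (p x t : 'rV[R]_n) :
  (forall i, continuous (f i)) -> (forall i, class_C1 (f i)) ->
  zero_set f x -> \det (gram (grads f x)) != 0 ->
  (forall z, zero_set f z -> enorm (p - x) <= enorm (p - z)) ->
  (forall i, dotp (grad (f i) x) t = 0) -> dotp (p - x) t = 0.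
Proof.
move=> cf fC1 fx0 detx minx tperp.
pose s z := \det (gram (grads f z)) *: t - adj_proj (grads f z) t.
pose Phi z := dotp (z - p + (z - x)) (s z).
have s_perp z i : dotp (grad (f i) z) (s z) = 0.
  by rewrite dotpBr dotpZr (dotp_adj_proj (grads f z)) subrr.
have Phi_near (e : R) : 0 < e -> exists2 z, `|z - x| < e & Phi z = 0.
  move=> e0.
  pose F z := dotp (z - p) (z - p) + dotp (z - x) (z - x).
  pose h z := \sum_i f i z ^+ 2.
  have ccoord (q : 'rV[R]_n) i : continuous (fun z : 'rV[R]_n => (z - q) 0 i).
    move=> z; have -> : (fun z : 'rV[R]_n => (z - q) 0 i) = (fun z => z 0 i - q 0 i).
      by apply/funext => y; rewrite !mxE.
    by apply: continuous_sub_at; [exact: coord_continuous|exact: cst_continuous].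
  have cF : continuous F.
    by move=> z; refine (continuous_add_at _ _ z _ _);
      apply: continuous_dotp_at => i; exact: ccoord.
  have ch : continuous h.
    by move=> z; apply: continuous_sum_at => i; apply: continuousM; exact: cf.
  have h0 z : 0 <= h z by apply: sumr_ge0 => i _; exact: sqr_ge0.
  have hx0 : h x = 0 by apply: big1 => i _; rewrite fx0 expr0n.
  have hM z : h z = 0 -> zero_set f z.
    move/eqP; rewrite psumr_eq0 => [/allP H i|i _]; last exact: sqr_ge0.
    by have := H i (mem_index_enum i); rewrite sqrf_eq0 => /eqP.
  have Fx z : h z = 0 -> z <> x -> F x < F z.
    move=> /hM/minx dz /eqP zx; rewrite /F subrr dotp0l addr0.
    rewrite -!sqr_enorm ltr_pwDr ?exprn_gt0//.
      by rewrite lt0r enorm_eq0 subr_eq0 zx enorm_ge0.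
    by rewrite -(opprB p) -(opprB p z) !enormN lerXn2r ?nnegrE ?enorm_ge0.
  have [m [z [ze minz]]] := penalty_minimizer F h x e e0 cF ch h0 hx0 Fx.
  exists z => //.
  pose dG r := 2 * dotp (z - p + r *: s z) (s z) + 2 * dotp (z - x + r *: s z) (s z)
     + m * \sum_i 2 * f i (z + r *: s z) * dotp (grad (f i) (z + r *: s z)) (s z).
  have dGP (r : R) : is_derive r 1
      (fun r => F (z + r *: s z) + m * h (z + r *: s z)) (dG r).
    apply: is_deriveD.
      have -> : (fun r => F (z + r *: s z)) =
          (fun r => dotp (z - p + r *: s z) (z - p + r *: s z)) +
          (fun r => dotp (z - x + r *: s z) (z - x + r *: s z)).
        by apply/funext => y; rewrite fctE /F !(addrAC z _ (- _)).
      by apply: is_deriveD; exact: is_derive_sqr_line.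
    have -> : (fun r => m * h (z + r *: s z)) =
        m \*: (\sum_i (fun r => f i (z + r *: s z)) ^+ 2).
      by apply/funext => y; rewrite /h /= fct_sumE.
    apply: is_deriveZ; apply: is_derive_sum => i.
    have := is_derive_grad_line (f i) z (s z) r (fC1 i) => d.
    by have := @is_deriveX _ _ _ 2 _ _ _ d; rewrite expr1.
  have := line_min_derive0 _ _ _ _ _ _ ze minz dGP.
  rewrite /dG !scale0r !addr0 big1 => [|i _]; last by rewrite s_perp mulr0.
  by rewrite mulr0 addr0 -mulrDr -dotpDl => /eqP; rewrite mulf_eq0 pnatr_eq0/= => /eqP.
have cPhi : {for x, continuous Phi}.
  have cgrad i l : {for x, continuous (fun z => grads f z i 0 l)}.
    have -> : (fun z => grads f z i 0 l) = 'D_('e_l) (f i).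
      by apply/funext => z; rewrite mxE.
    exact: (fC1 i l x).2.
  apply: continuous_dotp_at => l.
    have -> : (fun z : 'rV[R]_n => (z - p + (z - x)) 0 l) =
        (fun z => (z 0 l - p 0 l) + (z 0 l - x 0 l)).
      by apply/funext => y; rewrite !mxE.
    by refine (continuous_add_at _ _ x _ _); apply: continuous_sub_at;
       [exact: coord_continuous|exact: cst_continuous
       |exact: coord_continuous|exact: cst_continuous].
  have -> : (fun z => s z 0 l) =
      (fun z => \det (gram (grads f z)) * t 0 l - adj_proj (grads f z) t 0 l).
    by apply/funext => y; rewrite !mxE.
  apply: continuous_sub_at; last exact: continuous_adj_proj_at.
  apply: continuousM; last exact: cst_continuous.
  apply: continuous_det_at => i j.
  have -> : (fun z => gram (grads f z) i j) = (fun z => dotp (grads f z i) (grads f z j)).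
    by apply/funext => y; rewrite mxE.
  by apply: continuous_dotp_at => a; exact: cgrad.
have Phi0 : Phi x = 0.
  apply/eqP; rewrite -normr_le0; apply/ler_addgt0Pr => e e0; rewrite add0r.
  have /nbhs_ballP[r /= r0 near_x] : \forall y \near x, `|Phi x - Phi y| < e.
    by move/cvgrPdist_lt : cPhi => /(_ e e0).
  have [z zr z0] := Phi_near r r0.
  have := near_x z; rewrite -ball_normE /= distrC zr z0 subr0 => /(_ isT).
  exact: ltW.
have adj0 : adj_proj (grads f x) t = 0.
  by apply: big1 => i _; apply: big1 => j _; rewrite tperp mulr0 scale0r.
move: Phi0; rewrite /Phi /s adj0 subr0 subrr addr0 dotpZr -opprB dotpNl.
by move/eqP; rewrite mulf_eq0 (negbTE detx) oppr_eq0 => /eqP.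
Qed.

End Penalty.

(** * Nearest points and reach *)

Section Nearest.
Context {R : realType} {N : nat}.
Implicit Types (M : set 'rV[R]_N) (p x y : 'rV[R]_N).

Lemma nearestP M p x :
  nearest M p x <-> M x /\ forall z, M z -> enorm (p - x) <= enorm (p - z).
Proof.
have symd z : enorm (z - p) = enorm (p - z) by rewrite -enormN opprB.
split=> [[Mx dx]|[Mx minx]]; split=> //.
  move=> z Mz; rewrite -lee_fin dx -symd.
  by apply: ereal_inf_lbound; exists z.
apply/le_anti/andP; split; last first.
  by rewrite -symd; apply: ereal_inf_lbound; exists x.
rewrite leNgt; apply/negP => /ereal_inf_ltP[_ [z Mz <-]].
by rewrite lte_fin ltNge symd minx.
Qed.

Lemma compact_nearest_exists M p : compact M -> M !=set0 ->
  exists x, nearest M p x.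
Proof.
move=> cM M0.
have cd : continuous (fun z : 'rV[R]_N => dotp (p - z) (p - z)).
  have ccoord i : continuous (fun z : 'rV[R]_N => (p - z) 0 i).
    move=> z; have -> : (fun z : 'rV[R]_N => (p - z) 0 i) = (fun z => p 0 i - z 0 i).
      by apply/funext => y; rewrite !mxE.
    by apply: continuous_sub_at; [exact: cst_continuous|exact: coord_continuous].
  move=> z.
  pose d (y : 'rV[R]_N) := p - y.
  by refine (continuous_dotp_at _ d d z _ _) => i; exact: ccoord.
have [x /set_mem Mx minx] := compact_EVT_min M0 cM (continuous_subspaceT cd).
exists x; apply/nearestP; split=> // z Mz.
by apply: ler_wsqrtr; apply: minx; exact/mem_set.
Qed.

Lemma le_reach M (r : R) : compact M -> 0 <= r ->
  (forall p x y, nearest M p x -> nearest M p y -> enorm (p - x) < r -> x = y) ->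
  (r%:E <= reach M)%E.
Proof.
move=> cM r0 uniq; apply: ereal_sup_ubound; exists r => //; split=> // p tp.
have M0 : M !=set0 by have /ereal_inf_ltP[_ [s Ms _] _] := tp; exists s.
have [x px] := compact_nearest_exists M p cM M0.
exists x; split=> // y py; apply: (uniq p) => //.
by case: px => _ dx; rewrite -lte_fin dx.
Qed.

Lemma convex_segment (U : set 'rV[R]_N) x y (t : R) :
  convex_set U -> U x -> U y -> 0 <= t <= 1 -> U (x + t *: (y - x)).
Proof.
move=> cU Ux Uy /andP[t0 t1].
have := cU y x (Itv01 t0 t1) (mem_set Uy) (mem_set Ux) => /set_mem.
have -> : x + t *: (y - x) = t *: y + (1 - t) *: x.
  by rewrite scalerBl scale1r scalerBr addrCA.
by [].
Qed.

(** The chord joining two zeros of h leaves the tangent hyperplane at x only to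
    second order; convexity keeps the chord where the Hessian bound holds. *)
Lemma gradient_secant (U : set 'rV[R]_N) (h : 'rV[R]_N -> R) x y (C : R) :
  smooth h -> convex_set U -> (forall z, U z -> opnorm2 (hess h z) <= C) ->
  U x -> U y -> h x = 0 -> h y = 0 ->
  `|dotp (grad h x) (y - x)| <= C / 2 * enorm (y - x) ^+ 2.
Proof.
move=> sh cU hC Ux Uy hx hy.
have := taylor2_norm h x (y - x) C sh
  (fun t t01 => hC _ (convex_segment _ _ _ _ cU Ux Uy t01)).
by rewrite (addrC x) subrK hx hy subrr sub0r normrN.
Qed.

(** Put w = p - x and v = y - x, and let n be the component of v normal to the
    zero set at x. Equality of |w| and |w - v| reads |v|^2 = 2 <w, v>. Since w is
    normal this is 2 <w, n>, at most 2 |w| |n|, whereas |n| is of order |v|^2 by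
    the secant estimate. Dividing by |v|^2 leaves a lower bound on |w|. *)
Lemma nearest_points_far (k : nat) (f : 'I_k -> 'rV[R]_N -> R)
    (U : set 'rV[R]_N) (C4 C5 C6 : R) p x y :
  (forall i, smooth (f i)) -> zero_set f `<=` U -> convex_set U -> 0 < C5 ->
  (forall z, U z -> norm1 (gram (grads f z)) <= C4) ->
  (forall z, U z -> C5 <= `|\det (gram (grads f z))|) ->
  (forall z, U z -> forall i, opnorm2 (hess (f i) z) <= C6) ->
  nearest (zero_set f) p x -> nearest (zero_set f) p y -> x <> y ->
  Num.sqrt C5 <= enorm (p - x) * (k%:R * C6 * Num.sqrt (C4 ^+ k.-1)).
Proof.
move=> fs MU cU C5_gt0 gC4 gC5 hC6 /nearestP[Mx minx] /nearestP[My miny] xy.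
have [Ux Uy] : U x /\ U y by split; apply: MU.
pose u := grads f x; pose v := y - x; pose w := p - x.
have det0 : \det (gram u) != 0.
  by rewrite -normr_gt0; exact: lt_le_trans C5_gt0 (gC5 x Ux).
have b_le i : `|dotp (u i) v| <= C6 / 2 * enorm v ^+ 2.
  by apply: (gradient_secant U) => // z Uz; exact: hC6.
have [n [vn_perp n_le]] := normal_part u v det0.
have wv : dotp w v = dotp w n.
  apply/eqP; rewrite -subr_eq0 -dotpBr; apply/eqP.
  apply: (lagrange_orthogonality _ f p x (v - n)) => // i.
  - exact: smooth_continuous.
  - exact: smooth_C1.
have vw : enorm v ^+ 2 = 2 * dotp w n.
  have pxy : enorm (p - x) = enorm (p - y) by apply/le_anti; rewrite minx ?miny.
  have : enorm (p - y) ^+ 2 = enorm (w - v) ^+ 2.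
    by rewrite /w /v opprB addrA subrK.
  by rewrite -pxy -/w (sqr_enormB w v) wv; lra.
have v_gt0 : 0 < enorm v ^+ 2.
  rewrite exprn_gt0// lt0r enorm_eq0 subr_eq0 enorm_ge0 andbT.
  by apply/eqP => yx; apply: xy.
have C4_ge0 : 0 <= C4 by apply: le_trans (gC4 x Ux); exact: norm1_ge0.
have P_ge0 : 0 <= C4 ^+ k.-1 / C5 by rewrite divr_ge0 ?exprn_ge0// ltW.
have C6v_ge0 : 0 <= k%:R * (C6 / 2 * enorm v ^+ 2).
  have [->|k0] := posnP k; first by rewrite mul0r.
  by rewrite mulr_ge0// (le_trans _ (b_le (Ordinal k0))).
have sum_b_le : \sum_i `|dotp (u i) v| <= k%:R * (C6 / 2 * enorm v ^+ 2).
  apply: le_trans (ler_sum _ (fun i _ => b_le i)) _.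
  by rewrite sumr_const card_ord mulr_natl.
have n_le' : enorm n <= Num.sqrt (C4 ^+ k.-1 / C5) * (k%:R * (C6 / 2 * enorm v ^+ 2)).
  have rhs_ge0 := mulr_ge0 (sqrtr_ge0 (C4 ^+ k.-1 / C5)) C6v_ge0.
  rewrite -ler_sqr ?nnegrE ?enorm_ge0 ?rhs_ge0// exprMn (sqr_sqrtr P_ge0).
  apply: (le_trans n_le); apply: ler_pM.
  - by rewrite divr_ge0// exprn_ge0// norm1_ge0.
  - exact: sqr_ge0.
  - apply: ler_pM.
    + by rewrite exprn_ge0// norm1_ge0.
    + by rewrite invr_ge0.
    + by rewrite lerXn2r ?nnegrE ?norm1_ge0// gC4.
    + by rewrite lef_pV2 ?posrE ?normr_gt0// gC5.
  - by rewrite lerXn2r ?nnegrE// sumr_ge0.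
have : enorm v ^+ 2 <= enorm w * (k%:R * C6 * Num.sqrt (C4 ^+ k.-1 / C5)) * enorm v ^+ 2.
  rewrite {1}vw.
  have H1 : dotp w n <= enorm w * enorm n.
    exact: le_trans (ler_norm _) (dotp_le_enorm _ _).
  have H2 := ler_wpM2l (enorm_ge0 w) n_le'.
  have := le_trans H1 H2; lra.
rewrite ler_pMl// sqrtrM ?exprn_ge0// sqrtrV; last exact: ltW.
by rewrite !mulrA ler_pdivlMr ?mul1r// sqrtr_gt0.
Qed.

Lemma zero_set_reach_ge (k : nat) (f : 'I_k -> 'rV[R]_N -> R)
    (U : set 'rV[R]_N) (C4 C5 C6 r : R) :
  (forall i, smooth (f i)) -> compact (zero_set f) -> zero_set f `<=` U ->
  convex_set U -> 0 < C5 ->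
  (forall z, U z -> norm1 (gram (grads f z)) <= C4) ->
  (forall z, U z -> C5 <= `|\det (gram (grads f z))|) ->
  (forall z, U z -> forall i, opnorm2 (hess (f i) z) <= C6) ->
  0 <= r -> 0 <= C6 ->
  r * (k%:R * C6 * Num.sqrt (C4 ^+ k.-1)) <= Num.sqrt C5 ->
  (r%:E <= reach (zero_set f))%E.
Proof.
move=> fs cM MU cU C5_gt0 gC4 gC5 hC6 r0 C6_ge0 rle; apply: le_reach => // p x y px py xr.
apply: contrapT => xy.
have := nearest_points_far _ _ _ _ _ _ _ _ _ fs MU cU C5_gt0 gC4 gC5 hC6 px py xy.
set K := k%:R * C6 * _ in rle *.
have K_ge0 : 0 <= K by rewrite !mulr_ge0 ?sqrtr_ge0.
have sC5 : 0 < Num.sqrt C5 by rewrite sqrtr_gt0.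
rewrite leNgt => /negP; apply.
have [K0|K_neq0] := eqVneq K 0; first by rewrite K0 mulr0.
by rewrite (lt_le_trans _ rle)// ltr_pM2r// lt0r K_neq0.
Qed.

End Nearest.

Theorem corollaryA17 (R : realType) (N k : nat) (k_gt0 : (0 < k)%N)
  (f : 'I_k -> 'rV[R]_N -> R) (M U : set 'rV[R]_N) (C4 C5 C6 C7 : R)
  (f_smooth : forall i, smooth (f i))
  (M_zero : M = zero_set f)
  (M_closed : closed_embedded_submanifold M)
  (M_sub_U : M `<=` U)
  (U_convex : convex_set U)
  (C5_gt0 : 0 < C5)
  (g_le : forall x, U x -> norm1 (gram (grads f x)) <= C4)
  (det_g_ge : forall x, U x -> C5 <= `|\det (gram (grads f x))|)
  (hess_le : forall x, U x -> forall i, opnorm2 (hess (f i) x) <= C6)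
  (grad_le : forall x, U x -> forall i, enorm (grad (f i) x) <= C7) :
  (* g, hence C_3, is a function on U: the bound holds with its value at
     every point *)
  forall x, U x ->
  ((Num.min
     (k%:R `^ (- 4 - (k%:R - 1) / 4)
      * (Num.sqrt C5 / (C4 `^ ((k%:R - 1) / 2) * C6)))
     (1 / 2 * (1 / (2 * k%:R * C6 * C3 (grads f x)
                    * (C7 * C3 (grads f x) * k%:R + 1)))))%:E
   <= reach M)%E.
Proof.
move=> x Ux; subst M.
have C6_ge0 : 0 <= C6.
  exact: le_trans (opnorm2_ge0 _) (hess_le x Ux (Ordinal k_gt0)).
have C4_ge0 : 0 <= C4 by apply: le_trans (g_le x Ux); exact: norm1_ge0.
have kB1 : k%:R - 1 = k.-1%:R :> R by rewrite -subn1 natrB.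
have k1 : 1 <= k%:R :> R by rewrite ler1n.
set P := C4 `^ _; set a := k%:R `^ _.
have P_ge0 : 0 <= P by exact: powR_ge0.
have PE : Num.sqrt (C4 ^+ k.-1) = P.
  by rewrite -powR12_sqrt ?exprn_ge0// -powR_mulrn// -powRrM -kB1.
have a_ge0 : 0 <= a by exact: powR_ge0.
have ak : a * k%:R <= 1.
  have k_gt0' : 0 < k%:R :> R by rewrite ltr0n.
  rewrite -ler_pdivlMr// mul1r -[leRHS]powR_inv1; last exact: ltW.
  by apply: ler_powR => //; rewrite kB1; have := ler0n R k.-1; lra.
apply: le_trans (zero_set_reach_ge _ _ U C4 C5 C6
  (a * (Num.sqrt C5 / (P * C6))) f_smooth M_closed.1 M_sub_U U_convex C5_gt0
  g_le det_g_ge hess_le _ C6_ge0 _).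
- by rewrite lee_fin ge_min lexx.
- by rewrite !mulr_ge0 ?invr_ge0 ?mulr_ge0 ?sqrtr_ge0.
rewrite PE.
(* If P * C6 = 0 the bound degenerates to 0, because 0^-1 = 0. *)
have [PC0|PC_neq0] := eqVneq (P * C6) 0.
  by rewrite PC0 invr0 !mulr0 mul0r sqrtr_ge0.
have -> : a * (Num.sqrt C5 / (P * C6)) * (k%:R * C6 * P) = a * k%:R * Num.sqrt C5.
  by field; rewrite mulf_eq0 negb_or andbC in PC_neq0.
by rewrite ler_piMl ?sqrtr_ge0.
Qed.
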